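(* Let $\mathcal G$ be a connected compact metric graph, let $\mathcal V^D\subseteq\mathcal V$ be a nonempty set of degree-one vertices, and let $1<p<\infty$. Then $$\lambda_{1,p}(\mathcal G,\mathcal V^D)\,T_p(\mathcal G,\mathcal V^D)<|\mathcal G|^{p-1}.$$
   Context: A compact metric graph $\mathcal G$ is obtained from a finite combinatorial graph with vertex set $\mathcal V$ and finite edge set $\mathcal E$ by identifying the endpoints of compact intervals $[0,\ell_e]$, $\ell_e>0$, $e\in\mathcal E$, according to the graph structure; $|\mathcal G|=\sum_{e}\ell_e$ is its total length. $\mathcal E_v$ is the set of edges incident with $v$ (a loop at $v$ counted twice, once for each endpoint) and $\deg(v)=|\mathcal E_v|$. Set $\mathcal V^N=\mathcal V\setminus\mathcal V^D$. $u_e$ denotes the restriction of $u$ to $e$. $W^{1,p}(\mathcal G)$ is the space of $u:\mathcal G\to\mathbb R$ with $u|_e\in W^{1,p}(0,\ell_e)$ for all $e\in\mathcal E$ and $u$ continuous at every vertex; $W^{1,p}_{\mathcal V^D}(\mathcal G)=\{u\in W^{1,p}(\mathcal G): u(v)=0\ \forall v\in\mathcal V^D\}$. Integrals over $\mathcal G$ are sums of integrals over edges. The $p$-torsion function $w_p$ is the unique function in $W^{1,p}_{\mathcal V^D}(\mathcal G)$ with $-(|w_{p,e}'|^{p-2}w_{p,e}')'=1$ on each edge $e$, $w_p(v)=0$ for $v\in\mathcal V^D$, and $\sum_{e\in\mathcal E_v}|w_{p,e}'(v)|^{p-2}\partial_{\nu_e}w_{p,e}(v)=0$ for $v\in\mathcal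 V^N$, where $\partial_{\nu_e}$ is the derivative at $v$ in the outward direction along $e$ (pointing from $v$ into $e$). Equivalently, $\int_{\mathcal G}|w_p'|^{p-2}w_p'\phi'\,dx=\int_{\mathcal G}\phi\,dx$ for all $\phi\in W^{1,p}_{\mathcal V^D}(\mathcal G)$. The $p$-torsional rigidity is $T_p(\mathcal G,\mathcal V^D)=\bigl(\int_{\mathcal G}w_p\,dx\bigr)^{p-1}$. The first eigenvalue of the Dirichlet--Kirchhoff $p$-Laplacian is $$\lambda_{1,p}(\mathcal G,\mathcal V^D)=\inf_{u\in W^{1,p}_{\mathcal V^D}(\mathcal G),\,u\ne0}\frac{\int_{\mathcal G}|u'|^p\,dx}{\int_{\mathcal G}|u|^p\,dx}.$$ *)

(* Defs.v *)
From HB Require Import structures.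
From mathcomp Require Import all_boot all_order all_algebra.
From mathcomp Require Import all_classical all_reals all_analysis.

Set Implicit Arguments.
Unset Strict Implicit.
Unset Printing Implicit Defensive.

Import Order.TTheory GRing.Theory Num.Theory.
Import numFieldNormedType.Exports.

Local Open Scope ring_scope.
Local Open Scope classical_set_scope.

(* Loops and multiple edges are allowed.  The edge e is the interval
   [0, len e]; the point 0 is glued to src e and the point len e to tgt e. *)
Record metric_graph (R : realType) := MetricGraph {
  vertex : finType;
  edge : finType;
  src : edge -> vertex;
  tgt : edge -> vertex;
  len : edge -> R;
  len_gt0 : forall e, 0 < len e
}.

Section MetricGraph.
Context {R : realType} (G : metric_graph R).

Definition adjacent : rel (vertex G) := fun v w =>
  [exists e : edge G, ((src e == v) && (tgt e == w))
                   || ((src e == w) && (tgt e == v))].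

Definition connected_graph : Prop :=
  forall v w : vertex G, connect adjacent v w.

(* A loop contributes to both terms, hence counts twice. *)
Definition degree (v : vertex G) : nat :=
  (#|[set e : edge G | src e == v]%SET| + #|[set e : edge G | tgt e == v]%SET|)%N.

Definition total_length : R := \sum_(e : edge G) len e.

Definition graph_integral (f : edge G -> R -> R) : R :=
  \sum_(e : edge G) \int[lebesgue_measure]_(x in `]0, len e[) f e x.

End MetricGraph.

Section SobolevInterval.
Context {R : realType}.

Definition test_function (l : R) (phi : R -> R) : Prop :=
  (forall n x, derivable (phi^`(n)) x 1) /\
  (exists a b, [/\ 0 < a, b < l & forall x, x \notin `[a, b]%R -> phi x = 0]).

Definition weak_derivative (l : R) (u du : R -> R) : Prop :=
  forall phi, test_function l phi ->
    \int[lebesgue_measure]_(x in `]0, l[) (u x * derive1 phi x) =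
    - \int[lebesgue_measure]_(x in `]0, l[) (du x * phi x).

Definition in_Lp (p l : R) (f : R -> R) : Prop :=
  f \_ `]0, l[ \in Lfun (@lebesgue_measure R) p%:E.

(* u is the representative, continuous up to the endpoints, of an element of
   W^{1,p}(0, l), and du is a representative of its weak derivative. *)
Definition sobolev (p l : R) (u du : R -> R) : Prop :=
  [/\ {within `[0, l], continuous u}, in_Lp p l u, in_Lp p l du
    & weak_derivative l u du].

End SobolevInterval.

(* Only the values of on_edge e on [0, len e] are meaningful. *)
Record graph_function (R : realType) (G : metric_graph R) := GraphFunction {
  at_vertex : vertex G -> R;
  on_edge : edge G -> R -> R
}.

Section TorsionAndEigenvalue.
Context {R : realType} (G : metric_graph R) (VD : {set vertex G}) (p : R).
Implicit Types u w : graph_function G.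

Definition graph_sobolev u (du : edge G -> R -> R) : Prop :=
  (forall e, sobolev p (len e) (on_edge u e) (du e)) /\
  (forall e, on_edge u e 0 = at_vertex u (src e) /\
             on_edge u e (len e) = at_vertex u (tgt e)).

Definition graph_sobolev_dirichlet u (du : edge G -> R -> R) : Prop :=
  graph_sobolev u du /\ (forall v, v \in VD -> at_vertex u v = 0).

Definition nonzero_function u : Prop :=
  exists e x, x \in `[0, len e]%R /\ on_edge u e x != 0.

Definition rayleigh_quotient u (du : edge G -> R -> R) : R :=
  graph_integral (fun e x => `|du e x| `^ p) /
  graph_integral (fun e x => `|on_edge u e x| `^ p).

Definition first_eigenvalue : R :=
  inf [set r | exists u du, [/\ graph_sobolev_dirichlet u du,
                               nonzero_function u & r = rayleigh_quotient u du]].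

(* |t|^{p-2} t; it is 0 at t = 0 for every p. *)
Definition flux (t : R) : R := `|t| `^ (p - 2) * t.

(* One-sided difference quotients at the two ends of an edge, both taken in the
   direction pointing from the vertex into the edge. *)
Definition src_quotient u (e : edge G) (x : R) : R :=
  (on_edge u e x - on_edge u e 0) / x.

Definition tgt_quotient u (e : edge G) (x : R) : R :=
  (on_edge u e x - on_edge u e (len e)) / (len e - x).

Definition src_normal_derivative u (e : edge G) : R :=
  lim (src_quotient u e x @[x --> 0^'+]).

Definition tgt_normal_derivative u (e : edge G) : R :=
  lim (tgt_quotient u e x @[x --> (len e)^'-]).

Definition torsion_equation w (e : edge G) : Prop :=
  forall x, x \in `]0, len e[%R ->
    derivable (on_edge w e) x 1 /\
    is_derive x 1 (fun y => - flux (derive1 (on_edge w e) y)) 1.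

Definition derivable_at_ends w (e : edge G) : Prop :=
  cvg (src_quotient w e x @[x --> 0^'+]) /\
  cvg (tgt_quotient w e x @[x --> (len e)^'-]).

(* The modulus of the derivative of w along e at v does not depend on the
   direction, so each summand is the flux of the normal derivative. *)
Definition kirchhoff_condition w (v : vertex G) : Prop :=
  \sum_(e : edge G | src e == v) flux (src_normal_derivative w e) +
  \sum_(e : edge G | tgt e == v) flux (tgt_normal_derivative w e) = 0.

Definition is_torsion_function w : Prop :=
  [/\ exists dw, graph_sobolev_dirichlet w dw,
      forall e, torsion_equation w e,
      forall e, derivable_at_ends w e
    & forall v, v \notin VD -> kirchhoff_condition w v].

Definition torsional_rigidity w : R := graph_integral (on_edge w) `^ (p - 1).

End TorsionAndEigenvalue.

(* Main.v *)
Require Import Defs.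
From mathcomp Require Import all_boot all_order all_algebra.
From mathcomp Require Import all_classical all_reals all_analysis.
From mathcomp Require Import ring lra.

Import Order.TTheory GRing.Theory Num.Theory.
Import numFieldNormedType.Exports.

Local Open Scope ring_scope.

(* The torsion function w itself is a trial function for the first eigenvalue.
   Let q be the conjugate exponent of p, i.e. (p - 1)(q - 1) = 1, so that
   flux q inverts flux p.  On an edge e the equation says that the flux of w'
   is c_e - x, hence w' = flux q (c_e - x), which is continuous up to the
   endpoints: w is C^1 on closed edges, and the fluxes of its normal derivatives
   are c_e at the source and len e - c_e at the target.  Integration by parts on
   each edge, the Kirchhoff conditions and w = 0 on VD give
   int |w'|^p = int w =: I.  Let m = I / |G| be the mean of w.  Integrating the
   tangent inequality |t|^p >= m^p + p m^(p-1) (t - m), which is strict for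
   t <> m, gives int |w|^p > m^p |G|, since w is constant on no edge.  Hence
   lambda T <= I^p / int |w|^p < |G|^(p-1). *)

(** * Powers of the modulus, and the flux map on the real line *)

Section PowerFunctions.
Context {R : realType}.
Local Open Scope classical_set_scope.
Implicit Types (a m p q t x : R).

Lemma continuous_powR_gt0 {a x} : 0 < x -> {for x, continuous (@powR R ^~ a)}.
Proof.
move=> x0; apply/differentiable_continuous/derivable1_diffP.
by apply: derivable_powR; rewrite in_itv/= x0.
Qed.

Lemma continuous_normr_powR a : 0 < a -> continuous (fun x : R => `|x| `^ a).
Proof.
move=> a0 x; have [->|x0] := eqVneq x 0; last first.
  apply: (@continuous_comp _ _ _ (fun x : R => `|x|) (@powR R ^~ a)).
    exact: norm_continuous.
  by apply: continuous_powR_gt0; rewrite normr_gt0.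
rewrite /prop_for /continuous_at normr0 powR0 ?gt_eqF//.
apply/cvgrPdist_lt => /= e e0.
have d0 : 0 < e `^ a^-1 by rewrite powR_gt0.
near=> y; rewrite sub0r normrN ger0_norm ?powR_ge0//.
rewrite -[ltRHS](_ : (e `^ a^-1) `^ a = e); last first.
  by rewrite -powRrM mulVf ?gt_eqF// powRr1// ltW.
apply: gt0_ltr_powR; [by []|by rewrite nnegrE|by rewrite nnegrE ltW|].
near: y; exact: (@nbhs0_lt _ R^o _ d0).
Unshelve. all: by end_near. Qed.

Lemma norm_flux p t : 1 < p -> `|flux p t| = `|t| `^ (p - 1).
Proof.
move=> p1; rewrite /flux normrM (ger0_norm (powR_ge0 _ _)) mulrC.
have -> : p - 2 = (p - 1) - 1 by ring.
by rewrite mulr_powRB1// subr_gt0.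
Qed.

Lemma flux_mul p t : 0 < p -> flux p t * t = `|t| `^ p.
Proof.
move=> p0; rewrite /flux; have [->|t0] := eqVneq t 0.
  by rewrite normr0 mulr0 powR0 ?gt_eqF.
rewrite -mulrA -expr2 -real_normK ?num_real// -powR_mulrn//.
by rewrite -powRD ?subrK// normr_eq0 t0 implybT.
Qed.

Lemma fluxN p t : flux p (- t) = - flux p t.
Proof. by rewrite /flux normrN mulrN. Qed.

Lemma continuous_flux p : 1 < p -> continuous (flux p : R -> R).
Proof.
move=> p1 x; have [->|x0] := eqVneq x 0; last first.
  apply: (@continuousM R R^o (fun y : R => `|y| `^ (p - 2)) id); last exact: cvg_id.
  apply: (@continuous_comp _ _ _ (fun x : R => `|x|) (@powR R ^~ (p - 2))).
    exact: norm_continuous.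
  by apply: continuous_powR_gt0; rewrite normr_gt0.
(* For p < 2 the factor |x|^(p-2) is unbounded near 0, so continuity at 0 is read off from the
   modulus |x|^(p-1) of the whole product. *)
have flux0 : flux p (0 : R) = 0 by rewrite /flux mulr0.
have := @continuous_normr_powR (p - 1) _ 0; rewrite subr_gt0 => /(_ p1).
rewrite /prop_for /continuous_at flux0 normr0 powR0 ?subr_eq0 ?gt_eqF//.
move=> /cvgrPdist_lt /= h; apply/cvgrPdist_lt => e /h; apply: filterS => y.
by rewrite !sub0r !normrN norm_flux// ger0_norm// powR_ge0.
Qed.

(** The prefactors cancel: |flux p t|^(q-2) is |t| to the power (p-1)(q-2) = 1 - (p-1) = -(p-2). *)
Lemma fluxK p q t : 1 < p -> (p - 1) * (q - 1) = 1 -> flux q (flux p t) = t.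
Proof.
move=> p1 pq; have [->|t0] := eqVneq t 0; first by rewrite /flux !mulr0.
rewrite {1}/flux norm_flux// -powRrM.
have -> : (p - 1) * (q - 2) = - (p - 2).
  by transitivity ((p - 1) * (q - 1) - (p - 1)); [ring|rewrite pq; ring].
by rewrite /flux mulrA -powRD ?addNr ?powRr0 ?mul1r// normr_eq0 t0 implybT.
Qed.

(** Strict convexity of |t|^p at m. For m > 0 the tangent line is m^(p-1) (p t - (p-1) m), which is
    negative when t <= 0; only t > 0 needs an estimate. *)
Lemma powR_tangent_lt p m t : 1 < p -> 0 <= m -> t != m ->
  m `^ p + p * m `^ (p - 1) * (t - m) < `|t| `^ p.
Proof.
move=> p1; have p0 : 0 < p by lra.
rewrite le_eqVlt => /predU1P[<-|m0 tm].
  move=> t0; rewrite !powR0 ?subr_eq0 ?gt_eqF// mulr0 mul0r addr0.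
  by rewrite powR_gt0// normr_gt0.
have mp0 : 0 < m `^ p by rewrite powR_gt0.
rewrite -(mulr_powRB1 (ltW m0) p0) in mp0 *; set M := m `^ (p - 1) in mp0 *.
have M0 : 0 < M by rewrite powR_gt0.
have -> : m * M + p * M * (t - m) = M * (p * t - (p - 1) * m) by ring.
have [t0|t0] := leP t 0.
  apply: (@lt_le_trans _ _ 0); last exact: powR_ge0.
  by rewrite pmulr_rlt0//; nra.
rewrite gtr0_norm//.
(* With t = m e^s the claim reads p < e^((p - 1) s) + (p - 1) e^(- s). *)
pose s := ln (t / m); have tms : t / m = expR s by rewrite lnK// posrE divr_gt0.
have tE : t = m * expR s by rewrite -tms mulrC divfK// gt_eqF.
have s0 : s != 0.
  by apply: contra_neq tm => s0; rewrite tE s0 expR0 mulr1.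
rewrite tE powRM ?(ltW m0) ?expR_ge0// -(mulr_powRB1 (ltW m0) p0) -/M -expRM.
have -> : M * (p * (m * expR s) - (p - 1) * m) = m * M * (p * expR s - (p - 1)) by ring.
rewrite ltr_pM2l//.
(* In [A] plus p - 1 times [B] the terms in s cancel and the constants add up to p; strictness comes
   from [A], where s <> 0. *)
have A : 1 + (p - 1) * s < expR ((p - 1) * s).
  by apply: expR_gt1Dx; rewrite mulf_neq0// subr_eq0 gt_eqF.
have B : 1 + - s <= expR (- s) by exact: expR_ge1Dx.
have EA : expR (s * p) = expR s * expR ((p - 1) * s).
  by rewrite -expRD; congr expR; ring.
have EB : expR s * expR (- s) = 1 by rewrite -expRD subrr expR0.
have : expR s * p < expR s * (expR ((p - 1) * s) + (p - 1) * expR (- s)).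
  by rewrite ltr_pM2l ?expR_gt0//; nra.
by rewrite mulrDr mulrCA EB EA; lra.
Qed.

End PowerFunctions.

(** * Integrals over an open interval of functions continuous up to its ends *)

Section IntervalIntegrals.
Context {R : realType}.
Local Open Scope classical_set_scope.
Local Notation mu := (@lebesgue_measure R).
Implicit Types (f g F G : R -> R) (a b : R).

Lemma within_continuousM f g (A : set R) : {within A, continuous f} ->
  {within A, continuous g} -> {within A, continuous (fun x => f x * g x)}.
Proof. by move=> cf cg x; apply: continuousM; [exact: cf|exact: cg]. Qed.

Lemma continuous_integrable_oo f a b : {within `[a, b], continuous f} ->
  mu.-integrable `]a, b[ (EFin \o f).
Proof.
move=> cf; have cc : mu.-integrable `[a, b] (EFin \o f).
  by apply: continuous_compact_integrable => //; exact: segment_compact.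
refine (integrableS _ _ _ cc) => //.
by apply: subset_itv; rewrite bnd_simp.
Qed.

Lemma Rintegral_oo_cc f a b : {within `[a, b], continuous f} ->
  \int[mu]_(x in `]a, b[) f x = \int[mu]_(x in `[a, b]) f x.
Proof.
move=> cf; rewrite /Rintegral; congr fine; apply/esym/integral_itv_bndoo.
exact: measurable_int (continuous_integrable_oo _ _ _ cf).
Qed.

Lemma Rintegral_oo_by_parts F G f g a b : a < b ->
  {within `[a, b], continuous F} -> {within `[a, b], continuous f} ->
  (forall x, x \in `]a, b[%R -> is_derive x 1 F (f x)) ->
  {within `[a, b], continuous G} -> {within `[a, b], continuous g} ->
  (forall x, x \in `]a, b[%R -> is_derive x 1 G (g x)) ->
  \int[mu]_(x in `]a, b[) (F x * g x) =
  F b * G b - F a * G a - \int[mu]_(x in `]a, b[) (f x * G x).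
Proof.
move=> ab cF cf dF cG cg dG.
rewrite !Rintegral_oo_cc; [|exact: within_continuousM..].
have H (K k : R -> R) : {within `[a, b], continuous K} ->
    (forall x, x \in `]a, b[%R -> is_derive x 1 K (k x)) ->
    derivable_oo_LRcontinuous K a b /\ {in `]a, b[%R, K^`() =1 k}.
  move=> /(continuous_within_itvP _ ab)[_ Ka Kb] dK; split.
    by split => // x /dK[].
  by move=> x /dK dKx; rewrite derive1E derive_val.
have [HF HF'] := H _ _ cF dF; have [HG HG'] := H _ _ cG dG.
by rewrite (Rintegration_by_parts ab cf HF HF' cg HG HG').
Qed.

(** A zero integral would force f = 0 almost everywhere, but by continuity f > 0 on a whole ball
    around x, which has positive measure. *)
Lemma Rintegral_oo_gt0 f a b x : {within `[a, b], continuous f} ->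
  (forall y, y \in `]a, b[%R -> 0 <= f y) -> x \in `]a, b[%R -> 0 < f x ->
  0 < \int[mu]_(y in `]a, b[) f y.
Proof.
move=> cf f0 xab fx0.
have ab : a < b by move: xab; rewrite in_itv/= => /andP[]; exact: lt_trans.
have int_f := continuous_integrable_oo _ _ _ cf.
have I0 : 0 <= \int[mu]_(y in `]a, b[) f y by exact: Rintegral_ge0.
rewrite lt_neqAle I0 andbT; apply/negP => /eqP int0.
have /ae_eq_integral_abs : (\int[mu]_(y in `]a, b[) `|(f y)%:E| = 0)%E.
  under eq_integral => y /[!inE] yab do rewrite gee0_abs ?lee_fin ?f0//.
  by rewrite -[LHS]fineK ?integrable_fin_num// -[fine _]int0.
move=> /(_ (measurable_itv _) (measurable_int _ int_f)) h.
have /(continuous_within_itvP _ ab)[cfx _ _] := cf.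
have /nbhs_ballP[e /= e0 xe] : \forall y \near x, y \in `]a, b[%R /\ 0 < f y.
  apply: (@filterS2 _ _ _ _ _ _ _ (near_in_itvoo xab) (cvgr_gt _ (cfx _ xab) _ fx0)).
  by move=> y.
have ball0 : mu.-negligible (ball x e).
  apply: negligibleS h => y /xe[yab fy0] /= /(_ yab) [fy].
  by move: fy0; rewrite fy ltxx.
have := lebesgue_measure_ball x (ltW e0).
move/negligibleP : ball0 => ->; last by rewrite ball_itv; exact: measurable_itv.
by move=> [/esym/eqP]; rewrite mulrn_eq0/= gt_eqF.
Qed.

End IntervalIntegrals.

(** * The torsion equation on one interval *)

Section OneDimensionalProfile.
Context {R : realType}.
Local Open Scope classical_set_scope.
Implicit Types (f d : R -> R) (a b c l m p q : R).

Lemma derive1_eq1_itv f a b :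
  (forall x, x \in `]a, b[%R -> is_derive x 1 f 1) ->
  exists c, forall x, x \in `]a, b[%R -> f x = x - c.
Proof.
move=> df.
have key x y : x \in `]a, b[%R -> y \in `]a, b[%R -> x <= y -> f y - f x = y - x.
  move=> xab yab xy.
  have sub z : z \in `[x, y]%R -> z \in `]a, b[%R.
    move: xab yab; rewrite !in_itv/= => /andP[ax _] /andP[_ yb] /andP[xz zy].
    by rewrite (lt_le_trans ax)// (le_lt_trans zy).
  have cf : {within `[x, y], continuous f}.
    have df' : {in `[x, y]%R, forall z, derivable f z 1} by move=> z /sub/df[].
    exact: (derivable_within_continuous df').
  have df' z : z \in `]x, y[%R -> is_derive z 1 f 1.
    by move=> zxy; apply/df/sub; move: zxy; exact: subset_itv_oo_cc.
  have [c _ ->] := @MVT_segment R f (fun=> 1) x y xy df' cf.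
  by rewrite mul1r.
(* The constant is fixed by the value at the midpoint; the mean value theorem in [key] carries it to
   every other point. *)
exists ((a + b) / 2 - f ((a + b) / 2)) => x xab.
have hab : (a + b) / 2 \in `]a, b[%R.
  move: xab; rewrite !in_itv/= => /andP[ax xb].
  by rewrite midf_lt ?(lt_trans ax)//= midf_lt// (lt_trans ax).
have [xm|/ltW xm] := leP x ((a + b) / 2).
  have := key _ _ xab hab xm; lra.
have := key _ _ hab xab xm; lra.
Qed.

(** One integration of the equation gives flux p (f') = c - x; applying flux q recovers f'. *)
Lemma torsion_profile f a b p q : 1 < p -> (p - 1) * (q - 1) = 1 ->
  (forall x, x \in `]a, b[%R -> derivable f x 1 /\
     is_derive x 1 (fun y => - flux p (derive1 f y)) 1) ->
  exists c, forall x, x \in `]a, b[%R -> is_derive x 1 f (flux q (c - x)).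
Proof.
move=> p1 pq h.
have [x /h[]//|c hc] := derive1_eq1_itv (fun y => - flux p (derive1 f y)) a b.
exists c => x xab; have [fx _] := h _ xab.
have -> : c - x = flux p (derive1 f x) by rewrite -[RHS]opprK hc// opprB.
by rewrite fluxK// derive1E; exact/derivableP.
Qed.

(** By the mean value theorem the slope equals d z for some z between a and x, and d is continuous
    at a. *)
Lemma cvg_right_slope f d a b : a < b -> {within `[a, b], continuous f} ->
  (forall x, x \in `]a, b[%R -> is_derive x 1 f (d x)) -> {for a, continuous d} ->
  (f x - f a) / (x - a) @[x --> a^'+] --> d a.
Proof.
move=> ab cf df /cvgrPdist_lt da; apply/cvgrPdist_lt => e /da /nbhs_ballP[r /= r0 re].
near=> x.
have ax : a < x by near: x; exact: nbhs_right_gt.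
have xb : x < b by near: x; exact: nbhs_right_lt.
have xr : x < a + r by near: x; apply: nbhs_right_lt; rewrite ltrDl.
have cfx : {within `[a, x], continuous f}.
  by apply: continuous_subspaceW cf; apply: subset_itvl; rewrite bnd_simp ltW.
have dfx z : z \in `]a, x[%R -> is_derive z 1 f (d z).
  by move=> zax; apply: df; apply: subset_itvl zax; rewrite bnd_simp ltW.
have [z zax ->] := @MVT R f d a x ax dfx cfx.
rewrite mulfK ?subr_eq0 ?gt_eqF//; apply: re.
move: zax; rewrite in_itv/= => /andP[az zx].
by rewrite /ball/= ltr0_norm; lra.
Unshelve. all: by end_near. Qed.

(** The increment is divided by b - x, as in the derivative pointing from b into the interval; hence
    the sign of the limit. *)
Lemma cvg_left_slope f d a b : a < b -> {within `[a, b], continuous f} ->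
  (forall x, x \in `]a, b[%R -> is_derive x 1 f (d x)) -> {for b, continuous d} ->
  (f x - f b) / (b - x) @[x --> b^'-] --> - d b.
Proof.
move=> ab cf df /cvgrPdist_lt da; apply/cvgrPdist_lt => e /da /nbhs_ballP[r /= r0 re].
near=> x.
have xb : x < b by near: x; exact: nbhs_left_lt.
have ax : a < x by near: x; exact: nbhs_left_gt.
have xr : b - r < x by near: x; apply: nbhs_left_gt; rewrite gtrBl.
have cfx : {within `[x, b], continuous f}.
  by apply: continuous_subspaceW cf; apply: subset_itvr; rewrite bnd_simp ltW.
have dfx z : z \in `]x, b[%R -> is_derive z 1 f (d z).
  by move=> zxb; apply: df; apply: subset_itvr zxb; rewrite bnd_simp ltW.
have [z zxb fE] := @MVT R f d x b xb dfx cfx.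
rewrite -(opprB (f b)) fE mulNr mulfK ?subr_eq0 ?gt_eqF// -opprD normrN; apply: re.
move: zxb; rewrite in_itv/= => /andP[xz zb].
by rewrite /ball/= gtr0_norm; lra.
Unshelve. all: by end_near. Qed.

(** If f were equal to m throughout, its derivative flux q (c - x) would vanish everywhere, yet it
    vanishes at most at x = c. *)
Lemma nonconstant_profile f a b c q m : a < b ->
  (forall x, x \in `]a, b[%R -> is_derive x 1 f (flux q (c - x))) ->
  exists2 x, x \in `]a, b[%R & f x != m.
Proof.
move=> ab df; apply: contrapT => h.
have fm x : x \in `]a, b[%R -> f x = m.
  by move=> xab; apply: contrapT => /eqP fxm; apply: h; exists x.
have critical x : x \in `]a, b[%R -> x = c.
  move=> xab; have [_ fE] := df x xab.
  have : 'D_1 f x = 'D_1 (cst m) x.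
    by apply: near_eq_derive; near=> y; apply: fm; near: y; exact: near_in_itvoo.
  rewrite fE derive_cst /flux => /eqP.
  by rewrite mulf_eq0 powR_eq0 normr_eq0 orb_andl orbb subr_eq0 => /andP[/eqP].
have mid t : 0 < t < 1 -> a + t * (b - a) = c.
  by move=> /andP[t0 t1]; apply: critical; rewrite in_itv/=; nra.
(* Two distinct points of the interval would both equal c. *)
have := mid 2^-1 ltac:(lra); have := mid 3^-1 ltac:(lra); nra.
Unshelve. all: by end_near. Qed.

End OneDimensionalProfile.

(** * Energy and Sobolev regularity of the profile on one edge *)

Section ProfileEnergy.
Context {R : realType}.
Local Open Scope classical_set_scope.
Local Notation mu := (@lebesgue_measure R).
Implicit Types (f d u phi : R -> R) (c l p q : R).

Lemma continuous_profile q c : 1 < q -> continuous (fun x : R => flux q (c - x)).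
Proof.
move=> q1 x; apply: (@continuous_comp _ _ _ (fun y : R => c - y) (flux q)).
  by apply: (@continuousB R R^o); [exact: cvg_cst|exact: cvg_id].
exact: continuous_flux.
Qed.

Lemma is_derive_subr c (x : R) : is_derive x 1 (fun y : R => c - y) (-1).
Proof.
by rewrite -[X in is_derive _ _ _ X]sub0r; apply: is_deriveB.
Qed.

(** Since flux p inverts flux q, the integrand is (c - x) f'(x); integration by parts moves the
    derivative onto c - x, whose slope is -1. *)
Lemma profile_energy f l c p q : 0 < l -> 1 < p -> 1 < q -> (p - 1) * (q - 1) = 1 ->
  {within `[0, l], continuous f} ->
  (forall x, x \in `]0, l[%R -> is_derive x 1 f (flux q (c - x))) ->
  \int[mu]_(x in `]0, l[) `|flux q (c - x)| `^ p =
  (c - l) * f l - c * f 0 + \int[mu]_(x in `]0, l[) f x.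
Proof.
move=> l0 p1 q1 pq cf df.
transitivity (\int[mu]_(x in `]0, l[) ((c - x) * flux q (c - x))).
  apply: eq_Rintegral => x _; rewrite -(@flux_mul _ p) ?(lt_trans ltr01)//.
  by rewrite fluxK// mulrC.
have cd : {within `[0, l], continuous (fun x => flux q (c - x))}.
  by apply: continuous_subspaceT; exact: continuous_profile.
have cF : {within `[0, l], continuous (fun x : R => c - x)}.
  apply: continuous_subspaceT => x; apply: (@continuousB R R^o).
    exact: cvg_cst.
  exact: cvg_id.
rewrite (Rintegral_oo_by_parts _ _ (cst (-1)) _ _ _ l0 cF _ _ cf cd df).
- rewrite subr0; congr (_ + _).
  under eq_Rintegral do rewrite mulN1r.
  rewrite -[RHS]opprK; congr (- _).
  under eq_Rintegral do rewrite -mulN1r.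
  by rewrite RintegralZl ?mulN1r//; exact: continuous_integrable_oo.
- by apply: continuous_subspaceT => x; exact: cvg_cst.
- by move=> x _; exact: is_derive_subr.
Qed.

Lemma weak_derivative_within_C1 l u d : 0 < l ->
  {within `[0, l], continuous u} -> {within `[0, l], continuous d} ->
  (forall x, x \in `]0, l[%R -> is_derive x 1 u (d x)) -> weak_derivative l u d.
Proof.
move=> l0 cu cd du phi [dphi [a [b [a0 bl phi0]]]].
have dphi0 (x : R) : is_derive x 1 phi (phi^`() x).
  by rewrite derive1E; apply/derivableP; exact: (dphi 0%N x).
have cphi : {within `[0, l], continuous phi}.
  apply: continuous_subspaceT => x; apply/differentiable_continuous.
  by apply/derivable1_diffP; have [] := dphi0 x.
have cphi' : {within `[0, l], continuous phi^`()}.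
  apply: continuous_subspaceT => x; apply/differentiable_continuous.
  by apply/derivable1_diffP; exact: (dphi 1%N x).
rewrite (Rintegral_oo_by_parts _ _ _ _ _ _ l0 cu cd du cphi cphi') //.
(* Both endpoints lie outside the support of phi, so the boundary terms vanish. *)
rewrite !phi0 ?mulr0 ?subrr ?sub0r// in_itv/=; lra.
Qed.

Lemma in_Lp_continuous p l d : 0 < p -> continuous d -> in_Lp p l d.
Proof.
move=> p0 cd; rewrite /in_Lp.
have md : measurable_fun setT (d \_ `]0, l[).
  apply/(measurable_restrictT _ _).1 => //.
  by apply: measurable_funTS; exact: measurable_realfun.continuous_measurable_fun.
apply/andP; split; rewrite inE//= /finite_norm unlock poweR_lty//.
have cdp : {within `[0, l], continuous (fun x => `|d x| `^ p)}.
  apply: continuous_subspaceT => x.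
  apply: (@continuous_comp _ _ _ d (fun y => `|y| `^ p)); first exact: cd.
  exact: continuous_normr_powR.
have lp_lty : (\int[mu]_(x in `]0%R, l[) (`|d x| `^ p)%:E < +oo)%E.
  by apply: integrable_lty => //; exact: continuous_integrable_oo.
apply: le_lt_trans lp_lty; rewrite [leRHS]integral_mkcond le_eqVlt.
apply/orP; left; apply/eqP; apply: eq_integral => x _ /=.
by rewrite !patchE; case: ifPn => // _; rewrite normr0 powR0 ?gt_eqF.
Qed.

End ProfileEnergy.

(** The tangent inequality is integrated; one point with f x <> m makes it strict. Here m need not
    be the mean of f on this interval, so the linear term is kept: it cancels only after summing
    over edges. *)
Lemma lt_tangent_Rintegral {R : realType} (f : R -> R) (l m p x : R) :
  0 < l -> 1 < p -> 0 <= m -> {within `[0, l], continuous f}%classic ->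
  x \in `]0, l[ -> f x != m ->
  m `^ p * l + p * m `^ (p - 1) * (\int[lebesgue_measure]_(y in `]0, l[%classic) f y - m * l)
  < \int[lebesgue_measure]_(y in `]0, l[%classic) `|f y| `^ p.
Proof.
move=> l0 p1 m0 cf x0l fxm; have p0 : 0 < p by lra.
set A := m `^ p; set B := p * _.
have cfp : {within `[0, l], continuous (fun y => `|f y| `^ p)}%classic.
  by move=> y; exact: cvg_comp (cf y) (continuous_normr_powR p p0 (f y)).
have cst_cont r : {within `[0, l], continuous (fun=> r : R)}%classic.
  by apply: continuous_subspaceT => y; exact: cvg_cst.
have cBf := @within_continuousM _ (fun=> B) f _ (cst_cont B) cf.
have ck : {within `[0, l], continuous (fun y => (A - B * m) + B * f y)}%classic.
  by move=> y; exact: cvgD (cst_cont _ y) (cBf y).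
have -> : A * l + B * (\int[lebesgue_measure]_(y in `]0, l[%classic) f y - m * l) =
    \int[lebesgue_measure]_(y in `]0, l[%classic) ((A - B * m) + B * f y).
  rewrite RintegralD//; try exact: continuous_integrable_oo.
  rewrite Rintegral_cst//= lebesgue_measure_itv/= lte_fin l0 -EFinB subr0/=.
  by rewrite RintegralZl//; [ring|exact: continuous_integrable_oo].
rewrite -subr_gt0 -RintegralB//; try exact: continuous_integrable_oo.
have tangent y : (A - B * m) + B * f y = A + B * (f y - m) by ring.
apply: (@Rintegral_oo_gt0 _ _ 0 l x) => //.
- by move=> y; exact: cvgB (cfp y) (ck y).
- move=> y _; rewrite subr_ge0 tangent.
  have [->|fym] := eqVneq (f y) m; last exact/ltW/powR_tangent_lt.
  by rewrite subrr mulr0 addr0 ger0_norm.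
- by rewrite subr_gt0 tangent; exact: powR_tangent_lt.
Qed.

(** * The torsion function on the whole graph *)

Section TorsionFunction.
Context {R : realType} {G : metric_graph R} {VD : {set vertex G}} {p q : R}.
Context {w : graph_function G}.
Context (p1 : 1 < p) (q1 : 1 < q) (pq : (p - 1) * (q - 1) = 1).
Context (hw : is_torsion_function VD p w).

Definition torsion_derivative (c : edge G -> R) (e : edge G) (x : R) : R :=
  flux q (c e - x).

Lemma torsion_derivativeP : exists c : edge G -> R,
  forall e x, x \in `]0, len e[ ->
    is_derive x 1 (on_edge w e) (torsion_derivative c e x).
Proof.
have [_ eqw _ _] := hw.
have /choice[c hc] e := torsion_profile _ _ _ _ _ p1 pq (eqw e).
by exists c.
Qed.

Lemma torsion_continuous e : {within `[0, len e], continuous (on_edge w e)}%classic.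
Proof. by have [[dw [[/(_ e)[]]]]] := hw. Qed.

Lemma torsion_src e : on_edge w e 0 = at_vertex w (src e).
Proof. by have [[dw [[_ /(_ e)[]]]]] := hw. Qed.

Lemma torsion_tgt e : on_edge w e (len e) = at_vertex w (tgt e).
Proof. by have [[dw [[_ /(_ e)[]]]]] := hw. Qed.

Context {c : edge G -> R}.
Context (hc : forall e x, x \in `]0, len e[ ->
  is_derive x 1 (on_edge w e) (torsion_derivative c e x)).

(** Replaces the unspecified weak derivative of w by the explicit one, whose energy can be
    computed. *)
Lemma torsion_graph_sobolev : graph_sobolev_dirichlet VD p w (torsion_derivative c).
Proof.
have [[dw [[sw ends] dir]] _ _ _] := hw; split => //; split => // e.
have [cw lpw _ _] := sw e.
have cd : continuous (torsion_derivative c e) by exact: continuous_profile.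
split=> //; first by apply: in_Lp_continuous => //; exact: lt_trans p1.
apply: weak_derivative_within_C1 (hc e) => //; first exact: len_gt0.
exact: continuous_subspaceT.
Qed.

Lemma src_flux e : flux p (src_normal_derivative w e) = c e.
Proof.
rewrite -[RHS](fluxK q p _ q1) 1?mulrC//; congr flux.
apply: cvg_lim => //.
have := cvg_right_slope _ _ _ _ (len_gt0 e) (torsion_continuous e) (hc e)
  (continuous_profile q (c e) q1 _).
rewrite /torsion_derivative subr0; apply: cvg_trans; apply: near_eq_cvg.
by near=> x; rewrite /src_quotient subr0.
Unshelve. all: by end_near. Qed.

(** At the target the inward direction along the edge reverses the sign of w', and the flux is
    odd. *)
Lemma tgt_flux e : flux p (tgt_normal_derivative w e) = len e - c e.
Proof.
rewrite -[RHS]opprB -[c e - _](fluxK q p _ q1) 1?mulrC// -fluxN; congr flux.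
apply: cvg_lim => //.
exact: (cvg_left_slope _ _ _ _ (len_gt0 e) (torsion_continuous e) (hc e)
  (continuous_profile q (c e) q1 _)).
Qed.

(** Regrouped by vertices, the sum has at v the term w(v) times the total flux at v: the first
    factor vanishes on [VD], the second elsewhere. A loop enters through both of its ends. *)
Lemma kirchhoff_boundary_sum :
  \sum_e (c e * at_vertex w (src e) + (len e - c e) * at_vertex w (tgt e)) = 0.
Proof.
have [[dw [_ dir]] _ _ kir] := hw.
rewrite big_split/= (partition_big (@src _ G) predT)//=.
rewrite [X in _ + X](partition_big (@tgt _ G) predT)//= -big_split/=.
apply: big1 => v _; have [vD|vN] := boolP (v \in VD).
  by rewrite !big1 ?addr0// => e /eqP ->; rewrite dir// mulr0.
have kirv : \sum_(e | src e == v) c e + \sum_(e | tgt e == v) (len e - c e) = 0.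
  rewrite -[RHS](kir v vN); congr (_ + _); apply: eq_bigr => e _.
    by rewrite src_flux.
  by rewrite tgt_flux.
have := congr1 (fun z => z * at_vertex w v) kirv; rewrite mul0r mulrDl !mulr_suml.
by apply: etrans; congr (_ + _); apply: eq_bigr => e /eqP ->.
Qed.

Lemma torsion_energy :
  graph_integral (fun e x => `|torsion_derivative c e x| `^ p) =
  graph_integral (on_edge w).
Proof.
rewrite /graph_integral.
under eq_bigr => e _ do rewrite (profile_energy _ _ _ _ _ (len_gt0 e) p1 q1 pq
  (torsion_continuous e) (hc e)) torsion_src torsion_tgt.
rewrite big_split/= -[RHS]add0r; congr (_ + _).
(* The boundary terms of the edgewise energies are the opposites of those in
   [kirchhoff_boundary_sum]. *)
apply/eqP; rewrite -oppr_eq0 -sumrN -[X in _ == X]kirchhoff_boundary_sum.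
by apply/eqP/eq_bigr => e _; ring.
Qed.

(** The same m serves all edges; [e0] makes the sum of strict edge inequalities nonempty, hence
    strict. *)
Lemma torsion_jensen (m : R) (e0 : edge G) : 0 <= m ->
  m `^ p * total_length G
    + p * m `^ (p - 1) * (graph_integral (on_edge w) - m * total_length G) <
  graph_integral (fun e x => `|on_edge w e x| `^ p).
Proof.
move=> m0.
rewrite /total_length /graph_integral !mulr_sumr -sumrB mulr_sumr -big_split/=.
apply: ltr_sum; first by apply/hasP; exists e0; rewrite ?mem_index_enum.
move=> e _; have [x xe wxm] := nonconstant_profile _ _ _ _ _ m (len_gt0 e) (hc e).
exact: lt_tangent_Rintegral _ _ _ _ _ (len_gt0 e) p1 m0 (torsion_continuous e) xe wxm.
Qed.

End TorsionFunction.

(** * The eigenvalue bound from the trial function w *)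

Theorem proposition5p1 (R : realType) (G : metric_graph R)
    (VD : {set vertex G}) (p : R) (w : graph_function G)
    (hconn : connected_graph G)
    (hVD : VD != finset.set0)
    (hdeg : forall v, v \in VD -> degree v = 1%N)
    (hp : 1 < p)
    (hw : is_torsion_function VD p w) :
  first_eigenvalue VD p * torsional_rigidity p w < total_length G `^ (p - 1).
Proof.
(* A vertex of [VD] has degree one, so some edge is incident with it. *)
have [e0 _] : exists e0 : edge G, True.
  have /set0Pn[v /hdeg dv] := hVD.
  have : (0 < degree v)%N by rewrite dv.
  by rewrite /degree addn_gt0 => /orP[] /card_gt0P[e _]; exists e.
have p0 : 0 < p by lra.
have [q [q1 pq]] : exists q, 1 < q /\ (p - 1) * (q - 1) = 1.
  have p10 : p - 1 != 0 by lra.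
  exists (1 + (p - 1)^-1); split; last by rewrite addrAC subrr add0r mulfV.
  by rewrite ltrDl invr_gt0 subr_gt0.
have [c hc] := torsion_derivativeP hp pq hw.
have energy := torsion_energy hp q1 pq hw hc.
set I := graph_integral (on_edge w) in energy *.
set L := total_length G.
have L0 : 0 < L.
  rewrite /L /total_length (bigD1 e0)//= ltr_pwDl ?len_gt0// sumr_ge0// => e _.
  exact/ltW/len_gt0.
have integral_powR_ge0 (f : edge G -> R -> R) :
    0 <= graph_integral (fun e x => `|f e x| `^ p).
  by apply: sumr_ge0 => e _; apply: Rintegral_ge0 => x _; exact: powR_ge0.
(* I is an energy, hence nonnegative; this gives the m >= 0 required by the tangent inequality. *)
have I0 : 0 <= I by rewrite -energy.
pose m := I / L; have m0 : 0 <= m by rewrite divr_ge0// ltW.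
have IE : I = m * L by rewrite divfK// gt_eqF.
have := torsion_jensen hp hw hc m e0 m0.
(* With m the mean over the graph, I - m L = 0 and only m^p L < N remains. *)
rewrite -/I -/L {1}IE subrr mulr0 addr0.
set N := graph_integral _ => jensen.
have N0 : 0 < N by apply: le_lt_trans jensen; rewrite mulr_ge0 ?powR_ge0 ?ltW.
have lambda_le : first_eigenvalue VD p <= I / N.
  rewrite -energy; apply: ge_inf.
    by exists 0 => _ [u [du [_ _ ->]]]; apply: divr_ge0; exact: integral_powR_ge0.
  exists w, (torsion_derivative (q := q) c); split => //.
    exact: torsion_graph_sobolev.
  (* Nonconstancy with m = 0 shows that w is a nonzero trial function. *)
  have [x xe wx0] := nonconstant_profile _ _ _ _ _ 0 (len_gt0 e0) (hc e0).
  by exists e0, x; split => //; exact: subset_itv_oo_cc xe.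
apply: (@le_lt_trans _ _ (I / N * I `^ (p - 1))).
  by rewrite ler_wpM2r// powR_ge0.
(* The claim is now I^p < L^(p-1) N, and I^p = (m L)^p = L^(p-1) (m^p L). *)
rewrite mulrAC mulr_powRB1// ltr_pdivrMr// IE powRM ?(ltW L0)//.
by rewrite -(mulr_powRB1 (ltW L0) p0) mulrA mulrC ltr_pM2l// powR_gt0//.
Qed.
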